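(* Let $u\in C^4(\mathbb{R}^n)$ be convex and suppose that the Gaussian curvature $K^E_u$ of its graph $M_u\subset\mathbb{R}^{n+1}$ vanishes identically. Assume furthermore that the mean curvature $H^E_u$ of $M_u$ satisfies $$\lim_{x\to\infty} H^E_u(x)=0.$$ Then $M_u$ is a hyperplane.
   Context: For $u:\mathbb{R}^n\to\mathbb{R}$, $M_u=\{(x,u(x)):x\in\mathbb{R}^n\}$ is its graph, viewed as a hypersurface in the Euclidean space $\mathbb{R}^{n+1}$. Subscripts denote partial derivatives ($u_i=\partial u/\partial x_i$, $u_{ij}=\partial^2u/\partial x_i\partial x_j$) and repeated indices are summed from $1$ to $n$. With $w^E=1+\|Du\|^2$, the mean and Gaussian curvatures of $M_u$, as functions of $x\in\mathbb{R}^n$, are $$H^E_u=(w^E)^{-3/2}\left(w^E\,\Delta u-u_iu_ju_{ij}\right),\qquad K^E_u=(w^E)^{-(n+2)/2}\det D^2u .$$ The limit $x\to\infty$ means $\|x\|\to\infty$ in $\mathbb{R}^n$. *)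

(* Defs.v *)
From HB Require Import structures.
From mathcomp Require Import all_boot all_order all_algebra.
From mathcomp Require Import all_classical all_reals all_analysis.

Set Implicit Arguments.
Unset Strict Implicit.
Unset Printing Implicit Defensive.

Import Order.TTheory GRing.Theory Num.Theory.
Import numFieldNormedType.Exports.

Local Open Scope classical_set_scope.
Local Open Scope ring_scope.

(* The library norm `|x| on row vectors is the sup norm, so Euclidean
   quantities are written out with this inner product. *)
Definition dotp (R : realType) (m : nat) (x y : 'rV[R]_m) : R :=
  \sum_(i < m) x 0 i * y 0 i.

Definition enorm (R : realType) (m : nat) (x : 'rV[R]_m) : R :=
  Num.sqrt (dotp x x).

Section Calculus.
Variables (R : realType) (n : nat).
Implicit Types (u : 'rV[R]_n -> R) (x : 'rV[R]_n).

Definition partial (i : 'I_n) u : 'rV[R]_n -> R :=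
  fun x => 'D_(delta_mx 0 i) u x.

(* 'D_v is total, hence the explicit derivability requirement. *)
Fixpoint class_C (k : nat) u : Prop :=
  continuous u /\
  if k is k'.+1 then
    forall i : 'I_n, (forall x, derivable u x (delta_mx 0 i)) /\
                     class_C k' (partial i u)
  else True.

Definition gradient u x : 'rV[R]_n := \row_(i < n) partial i u x.

Definition hessian u x : 'M[R]_n :=
  \matrix_(i < n, j < n) partial i (partial j u) x.

Definition laplacian u x : R := \sum_(i < n) partial i (partial i u) x.

Definition wE u x : R := 1 + enorm (gradient u x) ^+ 2.

Definition mean_curvature u x : R :=
  wE u x `^ (- (3 / 2)) *
  (wE u x * laplacian u x
   - \sum_(i < n) \sum_(j < n)
       partial i u x * partial j u x * partial i (partial j u) x).

Definition gauss_curvature u x : R :=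
  wE u x `^ (- ((n + 2)%:R / 2)) * \det (hessian u x).

Definition graph_of u : set 'rV[R]_(n + 1) :=
  [set row_mx x (const_mx (u x)) | x in [set: 'rV[R]_n]].

(* Neighbourhoods of infinity, i.e. the filter enorm x --> +oo. *)
Definition infty_nbhs : set_system 'rV[R]_n :=
  [set P | exists M : R, forall x, M < enorm x -> P x].

Global Instance infty_nbhs_filter : Filter infty_nbhs.
Proof.
split.
- by exists 0.
- move=> P Q [M MP] [N NQ]; exists (Num.max M N) => x.
  by rewrite gt_max => /andP[/MP Px /NQ Qx].
- by move=> P Q PQ [M MP]; exists M => x /MP /PQ.
Qed.

End Calculus.

Arguments infty_nbhs R n : clear implicits.

Definition is_hyperplane (R : realType) (m : nat) (A : set 'rV[R]_m) : Prop :=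
  exists (v : 'rV[R]_m) (c : R), v != 0 /\ A = [set p | dotp v p = c].

(* Main.v *)
(** The Hessian of [u] is singular everywhere, which forces [u] to be affine
    along some direction [e].  Otherwise the differences of gradients of [u]
    span [R^n]; the tangent planes at finitely many points then show that
    [u - <p, x>] grows linearly for a mean [p] of gradients, so that
    [u - <p, x> - eps |x|^2] has an interior minimum on a large ball, where the
    Hessian of [u] is positive definite.

    Hence the graph, and with it [H], is invariant under translation along
    [e], so [H -> 0] at infinity gives [H = 0] everywhere.  Since the Hessian
    form [Q] is nonnegative, [Q(a) <= |a|^2 tr Q] for [a = Du], so that
    [w^(3/2) H >= Delta u >= 0] and the trace vanishes.  Then [Q = 0] and
    [u] is affine along every line. *)

Require Import Defs.
From HB Require Import structures.
From mathcomp Require Import all_boot all_order all_algebra.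
From mathcomp Require Import all_classical all_reals all_analysis.
From mathcomp Require Import ring lra.

Set Implicit Arguments.
Unset Strict Implicit.
Unset Printing Implicit Defensive.

Import Order.TTheory GRing.Theory Num.Theory.
Import numFieldNormedType.Exports.

Local Open Scope classical_set_scope.
Local Open Scope ring_scope.

(** * Derivatives along lines *)

Lemma is_derive_line (R : realType) (V : normedModType R) (f : V -> R)
    (x v : V) (s L : R) :
  is_derive (x + s *: v) v f L -> is_derive s (1 : R) (fun t => f (x + t *: v)) L.
Proof.
move=> [fd fL].
have E : (fun h : R => h^-1 *: (((fun t => f (x + t *: v)) \o shift s) (h *: 1)
                        - f (x + s *: v)))
       = (fun h : R => h^-1 *: ((f \o shift (x + s *: v)) (h *: v)
                        - f (x + s *: v))).
  apply/funext => h /=; rewrite -[h *: 1]/(h * 1) mulr1 scalerDl.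
  by rewrite addrCA.
by split; rewrite /derivable /derive E.
Qed.

Lemma is_derive_continuous (R : realType) (f : R -> R) (x l : R) :
  is_derive x (1 : R) f l -> {for x, continuous f}.
Proof. by case=> df _; apply: differentiable_continuous; apply/derivable1_diffP. Qed.

(** The increment [b] may have either sign, as it does in the difference quotients below; hence a
    bound on [|c|] instead of an interval for [c]. *)
Lemma MVT_line (R : realType) (V : normedModType R) (f g : V -> R) (x v : V)
    (b : R) :
  (forall s, is_derive (x + s *: v) v f (g (x + s *: v))) ->
  exists2 c, `|c| <= `|b| & f (x + b *: v) - f x = b * g (x + c *: v).
Proof.
move=> H.
have D s : is_derive s (1 : R) (fun t => f (x + t *: v)) (g (x + s *: v)).
  exact: is_derive_line.
have C A : {within A, continuous (fun t : R => f (x + t *: v))}.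
  by apply: continuous_subspaceT => s; apply: is_derive_continuous (D s).
have E0 : f x = f (x + 0 *: v) by rewrite scale0r addr0.
case: (leP 0 b) => b0.
- have [c] := MVT_segment b0 (fun s _ => D s) (C _).
  rewrite in_itv /= => /andP[c0 cb] E; exists c; first by rewrite !ger0_norm.
  by rewrite E0 E subr0 mulrC.
- have [c] := MVT_segment (ltW b0) (fun s _ => D s) (C _).
  rewrite in_itv /= => /andP[c0 cb] E; exists c.
    by rewrite !ler0_norm ?lerN2 // ltW.
  by rewrite E0 -opprB E sub0r mulrN opprK mulrC.
Qed.

(** The quotient along [v + a *: e] is the quotient along [v] plus an increment along [e] from the
    displaced point [h *: v + x]. By the mean value theorem the latter is [a] times a value of [g]
    near [x], and [g] is continuous at [x]. *)
Lemma is_derive_dirD (R : realType) (V : normedModType R) (f g : V -> R)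
    (x v e : V) (L a : R) :
  {for x, continuous g} -> (forall y, is_derive y e f (g y)) ->
  is_derive x v f L -> is_derive x (v + a *: e) f (L + a * g x).
Proof.
move=> cg fe [fv fL].
have fvL : (fun h => h^-1 *: ((f \o shift x) (h *: v) - f x)) @ 0^' --> L.
  by rewrite -fL; exact: fv.
suff H : (fun h => h^-1 *: ((f \o shift x) (h *: (v + a *: e)) - f x)) @ 0^'
    --> L + a * g x.
  by split; [apply/cvg_ex; eexists; exact: H | exact: cvg_lim H].
pose q (h : R) := h^-1 *: (f (h *: v + x + (h * a) *: e) - f (h *: v + x)).
have -> : (fun h => h^-1 *: ((f \o shift x) (h *: (v + a *: e)) - f x))
    = (fun h => h^-1 *: ((f \o shift x) (h *: v) - f x)) + q.
  apply/funext => h.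
  rewrite [RHS](_ : _ = h^-1 *: ((f \o shift x) (h *: v) - f x) + q h) //.
  rewrite /q -scalerDr /=; congr (_ *: _).
  by rewrite [RHS]addrC [RHS]addrA subrK scalerDr scalerA addrAC.
apply: cvgD => //.
apply/cvgrPdist_lt => eps eps0.
have a1 : 0 < `|a| + 1 by rewrite ltr_pwDr.
have : \forall y \near x, `|g x - g y| < eps / (`|a| + 1).
  by move/cvgrPdist_lt : cg; apply; rewrite divr_gt0.
move=> /nbhs_ballP [d /= d0 Hd].
(* The mean value point lies within [|h| * M] of [x]; the summand 1 makes [M] positive, so that
   [d / M] makes sense. *)
pose M := `|v| + `|a| * `|e| + 1.
have M0 : 0 < M by rewrite ltr_pwDr // addr_ge0 // mulr_ge0.
near=> h.
have h0 : h != 0 by near: h; exact: nbhs_dnbhs_neq.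
have hd : `|h| < d / M.
  by near: h; apply: dnbhs0_lt; rewrite divr_gt0.
have [c cb E] := @MVT_line R V f g (h *: v + x) e (h * a) (fun s => fe _).
rewrite /q E -[_ *: _]/(h^-1 * _) -[h * a * _]mulrA mulKf // -mulrBr normrM.
have : `|g x - g (h *: v + x + c *: e)| < eps / (`|a| + 1).
  apply: Hd; rewrite -ball_normE /ball_ /= addrAC opprD addrCA subrr addr0 normrN.
  rewrite ltr_pdivlMr // in hd; apply: le_lt_trans hd.
  rewrite (le_trans (ler_normD _ _)) // !normrZ /M !mulrDr mulr1 mulrA.
  rewrite normrM in cb.
  by rewrite -[leLHS]addr0 lerD // lerD // ler_wpM2r.
rewrite ltr_pdivlMr // => H.
apply: le_lt_trans H; rewrite mulrC ler_wpM2l // lerDl //.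
Unshelve. all: by end_near.
Qed.

(** * The inner product, and gradients as directional derivatives *)

Section DirectionalDerivatives.
Variables (R : realType) (n : nat).
Implicit Types (u : 'rV[R]_n -> R) (x y h k : 'rV[R]_n).

Lemma dotp_addr x h k : dotp x (h + k) = dotp x h + dotp x k.
Proof. by rewrite /dotp -big_split; apply: eq_bigr => i _; rewrite mxE mulrDr. Qed.

Lemma dotpC x h : dotp x h = dotp h x.
Proof. by apply: eq_bigr => i _; rewrite mulrC. Qed.

Lemma dotp_scaler (a : R) x h : dotp x (a *: h) = a * dotp x h.
Proof. by rewrite /dotp mulr_sumr; apply: eq_bigr => i _; rewrite mxE mulrCA. Qed.

Lemma dotp_scalel (a : R) x h : dotp (a *: x) h = a * dotp x h.
Proof. by rewrite dotpC dotp_scaler dotpC. Qed.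

Lemma dotp_addl x h k : dotp (h + k) x = dotp h x + dotp k x.
Proof. by rewrite dotpC dotp_addr !(dotpC x). Qed.

Lemma dotpNr x h : dotp x (- h) = - dotp x h.
Proof. by rewrite -scaleN1r dotp_scaler mulN1r. Qed.

Lemma dotpNl x h : dotp (- h) x = - dotp h x.
Proof. by rewrite dotpC dotpNr dotpC. Qed.

Lemma dotp_ge0 x : 0 <= dotp x x.
Proof. by apply: sumr_ge0 => i _; rewrite -expr2 sqr_ge0. Qed.

Lemma dotp_eq0 x : (dotp x x == 0) = (x == 0).
Proof.
apply/eqP/eqP => [x0|->]; last by rewrite /dotp big1 // => i _; rewrite !mxE mul0r.
have /psumr_eq0P H i : true -> 0 <= x 0 i * x 0 i by rewrite -expr2 sqr_ge0.
by apply/rowP => i; have /eqP := H x0 i isT; rewrite mulf_eq0 orbb mxE => /eqP.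
Qed.

Lemma dotp_gt0 x : x != 0 -> 0 < dotp x x.
Proof. by move=> x0; rewrite lt_neqAle dotp_ge0 eq_sym dotp_eq0 x0. Qed.

Lemma is_derive_dir0 u x : is_derive x 0 u 0.
Proof.
have H : (fun t : R => t^-1 *: ((u \o shift x) (t *: 0) - u x)) @ 0^' --> (0 : R).
  rewrite [X in X @ _](_ : _ = cst 0); first exact: cvg_cst.
  by apply/funext => t /=; rewrite scaler0 add0r subrr scaler0.
by split; [apply/cvg_ex; eexists; exact: H | exact: cvg_lim H].
Qed.

(** Derivatives along the basis vectors alone would not suffice. The direction [h] is built up one
    coordinate at a time by [is_derive_dirD], which is where continuity of the partial derivatives
    enters. *)
Lemma class_C_is_derive u x h :
  class_C 1 u -> is_derive x h u (dotp (gradient u x) h).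
Proof.
move=> [_ uC]; rewrite {1}(row_sum_delta h) /dotp.
elim/big_rec2: _ => [|i a b _ IH]; first exact: is_derive_dir0.
rewrite [_ *: _ + _]addrC [_ * _ + _]addrC mxE [_ * h 0 i]mulrC.
have [ud [cont _]] := uC i.
have := @is_derive_dirD R _ u (partial i u) x b (delta_mx 0 i) a (h 0 i) (cont x).
by apply=> // y; split.
Qed.

Lemma class_CS m u : class_C m.+1 u -> class_C m u.
Proof.
elim: m u => [|m IH] u [cu uC]; split=> // i.
by have [ud uCi] := uC i; split=> //; exact: IH.
Qed.

Lemma class_C_partial m u i : class_C m.+1 u -> class_C m (partial i u).
Proof. by case=> _ uC; have [] := uC i. Qed.

(** The row index of [hessian] is the outer derivative, so the direction of differentiation [h]
    multiplies on the left. Keeping this order avoids any appeal to symmetry of second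
    derivatives. *)
Lemma is_derive_dotp_gradient u x h k : class_C 2 u ->
  is_derive x h (fun y => dotp (gradient u y) k) (dotp (h *m hessian u x) k).
Proof.
move=> uC.
have -> : (fun y => dotp (gradient u y) k) = \sum_(j < n) (k 0 j \*: partial j u).
  apply/funext => y; rewrite fct_sumE /dotp; apply: eq_bigr => j _.
  by rewrite !mxE mulrC.
have -> : dotp (h *m hessian u x) k =
    \sum_(j < n) (k 0 j *: dotp (gradient (partial j u) x) h).
  rewrite /dotp; apply: eq_bigr => j _; rewrite !mxE -[_ *: _]/(_ * _) mulrC.
  by congr (_ * _); apply: eq_bigr => i _; rewrite !mxE mulrC.
apply: is_derive_sum => j; apply: is_deriveZ; apply: class_C_is_derive.
exact: class_C_partial.
Qed.

End DirectionalDerivatives.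

(** * First and second order consequences of convexity *)

Lemma derive_ge_right (R : realType) (f : R -> R) (L k : R) :
  is_derive (0 : R) (1 : R) f L ->
  (\forall t \near (0:R)^'+, k * t <= f t - f 0) -> k <= L.
Proof.
move=> [fd fL] H.
have : (fun h : R => h^-1 *: ((f \o shift 0) (h *: (1 : R)) - f 0)) @ 0^' --> L.
  by rewrite -fL; exact: fd.
(* The two-sided limit is also the limit from the right, so an estimate for small positive [t] is
   enough. *)
move/cvg_dnbhs_at_right => C; apply: cvgr_to_ge C _.
near=> t => /=.
have t0 : 0 < t by near: t; exact: nbhs_right_gt.
rewrite addr0 -[t *: 1]/(t * 1) mulr1 -[_ *: _]/(_ * _) mulrC ler_pdivlMr //.
by near: t.
Unshelve. all: by end_near.
Qed.

Section Convexity.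
Variables (R : realType) (n : nat) (u : 'rV[R]_n -> R).
Hypothesis u_convex : convex_function [set: 'rV[R]_n] u.
Implicit Types (x y h : 'rV[R]_n).

Lemma convex_ray x h t : 0 <= t -> t <= 1 ->
  u (x + t *: h) - u x <= t * (u (x + h) - u x).
Proof.
move=> t0 t1; have := u_convex (Itv01 t0 t1) (in_setT (x + h)) (in_setT x).
rewrite convRE /= /conv /= /unstable.onem.
have -> : t *: (x + h) + (1 - t) *: x = x + t *: h.
  by rewrite scalerDr scalerBl scale1r addrCA [_ *: _ + _ - _]addrAC subrr add0r.
by move=> H; lra.
Qed.

(** Divide [convex_ray] by [t] and let [t] decrease to 0. Signs are flipped first because
    [derive_ge_right] bounds slopes from below. *)
Lemma convex_gradient_le x h : class_C 1 u ->
  u x + dotp (gradient u x) h <= u (x + h).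
Proof.
move=> uC; rewrite addrC -lerBrDr -lerN2.
have D : is_derive (0 : R) (1 : R) (fun t => u (x + t *: h))
    (dotp (gradient u x) h).
  by apply: is_derive_line; rewrite scale0r addr0; exact: class_C_is_derive.
apply: (derive_ge_right (is_deriveN D)).
near=> t.
rewrite -[(- _) t]/(- u (x + t *: h)) -[(- _) 0]/(- u (x + 0 *: h)) scale0r addr0.
have t0 : 0 <= t by near: t; exact: nbhs_right_ge.
have t1 : t <= 1 by near: t; exact: nbhs_right_le.
have := convex_ray x h t0 t1; lra.
Unshelve. all: by end_near.
Qed.

(* The second difference of [u] bounds [t * (G t - G (- t))] from below, where
   [G t] is the slope of [u] at [x + t *: h] in direction [h]. *)
Lemma convex_hessian_ge x h k : class_C 2 u ->
  (\forall t \near (0 : R)^'+,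
     k * t ^+ 2 <= u (x + t *: h) + u (x - t *: h) - 2 * u x) ->
  k <= 2 * dotp (h *m hessian u x) h.
Proof.
move=> uC H; have uC1 := class_CS uC.
pose G (v : 'rV[R]_n) := fun t : R => dotp (gradient u (x + t *: v)) h.
have D v : is_derive (0 : R) (1 : R) (G v) (dotp (v *m hessian u x) h).
  apply: (@is_derive_line _ _ (fun y => dotp (gradient u y) h)).
  by rewrite scale0r addr0; exact: is_derive_dotp_gradient.
have -> : 2 * dotp (h *m hessian u x) h =
    dotp (h *m hessian u x) h - dotp (- h *m hessian u x) h.
  by rewrite mulNmx dotpNl; ring.
apply: (derive_ge_right (is_deriveB (D h) (D (- h)))).
near=> t.
rewrite -[(_ - _) t]/(G h t - G (- h) t) -[(_ - _) 0]/(G h 0 - G (- h) 0).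
have -> : G h 0 - G (- h) 0 = 0 by rewrite /G !scale0r subrr.
have t0 : 0 < t by near: t; exact: nbhs_right_gt.
have Ht : k * t ^+ 2 <= u (x + t *: h) + u (x - t *: h) - 2 * u x by near: t.
(* The tangent planes at [x + t *: h] and [x - t *: h] are both evaluated at the midpoint [x]; the
   two inequalities add up to the claim. *)
have := convex_gradient_le (x + t *: h) (- (t *: h)) uC1.
have := convex_gradient_le (x - t *: h) (t *: h) uC1.
rewrite addrK subrK dotpNr !dotp_scaler -scalerN => H1 H2.
rewrite subr0 -(ler_pM2r t0) /G -mulrA -expr2 mulrBl.
rewrite -scalerN in Ht; lra.
Unshelve. all: by end_near.
Qed.

Lemma convex_hessian_ge0 x h : class_C 2 u -> 0 <= dotp (h *m hessian u x) h.
Proof.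
move=> uC; have uC1 := class_CS uC.
suff : 0 <= 2 * dotp (h *m hessian u x) h by rewrite pmulr_rge0.
apply: convex_hessian_ge => //; near=> t; rewrite mul0r.
(* The tangent plane at [x] lies below [u] at both [x + t *: h] and [x - t *: h], and the linear
   terms cancel. *)
have := convex_gradient_le x (t *: h) uC1.
have := convex_gradient_le x (- (t *: h)) uC1.
rewrite dotpNr; lra.
Unshelve. all: by end_near.
Qed.

End Convexity.

(** * A flat direction from a singular Hessian *)

Lemma mx_entry_le (R : realType) n (y : 'rV[R]_n) i : `|y 0 i| <= `|y|.
Proof.
rewrite [leRHS]/Num.norm /= mx_normrE.
exact: (le_bigmax _ (fun ij : 'I_1 * 'I_n => `|y ij.1 ij.2|) (0, i)).
Qed.

Lemma mx_norm_le (R : realType) n (y : 'rV[R]_n) (K : R) :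
  0 <= K -> (forall i, `|y 0 i| <= K) -> `|y| <= K.
Proof.
move=> K0 H; rewrite [leLHS]/Num.norm /= mx_normrE.
by apply: bigmax_le => // -[i j] _; rewrite ord1.
Qed.

Lemma dotp_continuous (R : realType) n (p : 'rV[R]_n) : continuous (dotp p).
Proof.
rewrite /dotp.
apply: (continuous_big (op := +%R) (P := xpredT) (@add_continuous R)) => i _ y.
apply: (@continuousM _ _ (fun=> p 0 i) (fun z : 'rV_n => z 0 i)).
  exact: cst_continuous.
exact: coord_continuous.
Qed.

Lemma dotp_diag_continuous (R : realType) n :
  continuous (fun y : 'rV[R]_n => dotp y y).
Proof.
rewrite /dotp.
apply: (continuous_big (op := +%R) (P := xpredT) (@add_continuous R)) => i _ y.
by apply: (@continuousM _ _ (fun z : 'rV_n => z 0 i) (fun z : 'rV_n => z 0 i));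
  exact: coord_continuous.
Qed.

(** If no nonzero [e] annihilates [S], rows from [S] are collected greedily until the rank reaches
    [n]. *)
Lemma row_full_or_orthogonal (F : fieldType) n (S : set 'rV[F]_n) :
  (exists2 e : 'cV[F]_n, e != 0 & forall q, S q -> q *m e = 0) \/
  (exists m (A : 'M[F]_(m, n)), row_full A /\ forall i, S (row i A)).
Proof.
have [|noe] := pselect (exists2 e : 'cV[F]_n, e != 0 & forall q, S q -> q *m e = 0).
  by left.
right; suff H k : (k <= n)%N -> exists m (A : 'M[F]_(m, n)),
    (k <= \rank A)%N /\ forall i, S (row i A).
  have [m [A [rA SA]]] := H n (leqnn n); exists m, A; split=> //.
  by rewrite /row_full eqn_leq rank_leq_col rA.
elim: k => [_|k IH kn]; first by exists 0%N, 0; split=> // -[].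
have [m [A [rA SA]]] := IH (ltnW kn).
have [kA|Ak] := ltnP k (\rank A); first by exists m, A.
(* While the rank is below [n], a nonzero column [e] of the cokernel annihilates all rows of [A] but
   not some [q] in [S]. Such a [q] is outside the row space, so appending it raises the rank. *)
have : cokermx A != 0.
  by rewrite cokermx_eq0 /row_full neq_ltn (leq_ltn_trans Ak kn).
move=> /matrix0Pn [a [b ab]].
pose e := col b (cokermx A).
have e0 : e != 0 by apply/matrix0Pn; exists a, 0; rewrite mxE.
have Ae : A *m e = 0 by rewrite /e colE mulmxA mulmx_coker mul0mx.
have [q Sq qe] : exists2 q, S q & q *m e != 0.
  apply: contrapT => nq; apply: noe; exists e => // q Sq.
  by apply: contrapT => /eqP qe; apply: nq; exists q.
exists (m + 1)%N, (col_mx A q); split.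
  apply: leq_ltn_trans rA _; apply: rank_ltmx.
  rewrite ltmxE; apply/andP; split.
    apply/submxP; exists (row_mx 1%:M 0).
    by rewrite mul_row_col mul1mx mul0mx addr0.
  rewrite col_mx_sub submx_refl /=.
  by apply: contraNN qe => /submxP [D ->]; rewrite -mulmxA Ae mulmx0.
move=> i; case: (split_ordP i) => j ->.
  by rewrite rowKu.
by rewrite rowKd ord1 row_id.
Qed.

Section Touching.
Variables (R : realType) (n : nat) (u : 'rV[R]_n -> R).
Hypotheses (u_C2 : class_C 2 u) (u_convex : convex_function [set: 'rV[R]_n] u).

Lemma coercive_det_neq0 (p : 'rV[R]_n) (K C : R) : 0 < K ->
  (forall y, `|y| <= K * (u y - dotp p y + C)) ->
  exists x, \det (hessian u x) != 0.
Proof.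
move=> K0 H; pose v y := u y - dotp p y.
have vC0 : 0 <= v 0 + C by rewrite -(pmulr_rge0 _ K0); apply: le_trans (H 0).
(* For [r <= |y|] the growth bound gives [v 0 + C + 1 <= v y + C]. *)
pose r := K * (v 0 + C + 1).
have r0 : 0 < r by rewrite mulr_gt0 // ltr_wpDl.
have vr y : r <= `|y| -> v 0 + 1 <= v y.
  move=> /le_trans /(_ (H y)); rewrite /r ler_pM2l // /v; lra.
(* On the sup-norm ball of radius [r], [dotp y y] is at most [n * r ^+ 2]; this [eps] keeps the
   quadratic correction below 1, the gap of [v] on the boundary. *)
pose eps := (n%:R * r ^+ 2 + 1)^-1.
have d0 : 0 < n%:R * r ^+ 2 + 1 by rewrite ltr_wpDl // mulr_ge0 // sqr_ge0.
have eps0 : 0 < eps by rewrite invr_gt0.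
have dotp_le (y : 'rV[R]_n) : `|y| <= r -> dotp y y <= n%:R * r ^+ 2.
  move=> yr; rewrite /dotp mulr_natl -[X in _ *+ X]card_ord -sumr_const.
  apply: ler_sum => i _; rewrite -expr2 -[y 0 i ^+ 2]real_normK ?num_real //.
  by rewrite lerXn2r ?nnegrE ?(ltW r0) // (le_trans (mx_entry_le _ _)).
pose f y := v y - eps * dotp y y.
have cf : continuous f.
  move=> y; apply: (@continuousB _ _ _ v (fun z => eps * dotp z z)).
    apply: (@continuousB _ _ _ u (dotp p)); first exact: u_C2.1.
    exact: dotp_continuous.
  apply: (@continuousM _ _ (fun=> eps) (fun z : 'rV_n => dotp z z)).
    exact: cst_continuous.
  exact: dotp_diag_continuous.
pose A := [set y : 'rV[R]_n | `|y| <= r].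
have cA : compact A.
  apply: bounded_closed_compact.
    exists r; split; first exact: num_real.
    by move=> M rM z /= zr; apply: le_trans zr (ltW rM).
  have -> : A = closed_ball_ Num.norm (0 : 'rV[R]_n) r.
    by apply/seteqP; split=> z; rewrite /A /closed_ball_ /= sub0r normrN.
  exact: closed_closed_ball_.
have A0 : A 0 by rewrite /A /= normr0 ltW.
have [x] := EVT_min_rV (ex_intro _ 0 A0) cA (continuous_subspaceT cf).
rewrite inE => Ax xmin; exists x.
(* On the boundary [f] would exceed [v 0 = f 0], so the minimum is interior. *)
have xr : `|x| < r.
  rewrite lt_neqAle Ax andbT; apply/eqP => xr.
  have := xmin 0 (mem_set A0).
  have -> : f 0 = v 0.
    have /eqP d00 : dotp (0 : 'rV[R]_n) 0 == 0 by rewrite dotp_eq0.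
    by rewrite /f d00 mulr0 subr0.
  apply/negP; rewrite -ltNge /f.
  have := vr x; rewrite xr lexx => /(_ isT).
  have : eps * dotp x x < 1.
    rewrite /eps mulrC ltr_pdivrMr // mul1r.
    by rewrite (le_lt_trans (dotp_le _ Ax)) // ltrDl.
  lra.
(* Let [h] be a left null vector of the Hessian. Minimality of [x] makes the second difference of
   [u] along [h] at least that of [eps * dotp y y], namely [2 * eps * t ^+ 2 * dotp h h], which
   contradicts [hH]. *)
apply/negP => /det0P [h h0 hH].
have : 2 * eps * dotp h h <= 2 * dotp (h *m hessian u x) h.
  apply: convex_hessian_ge => //.
  near=> t.
  have t0 : 0 <= t by near: t; exact: nbhs_right_ge.
  have th : t * `|h| <= r - `|x|.
    rewrite -ler_pdivlMr; last by rewrite normr_gt0.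
    by near: t; apply: nbhs_right_le; rewrite divr_gt0 ?subr_gt0 ?normr_gt0.
  have Ap : A (x + t *: h).
    by rewrite /A /= (le_trans (ler_normD _ _)) // normrZ ger0_norm // -lerBrDl.
  have An : A (x - t *: h).
    by rewrite /A /= (le_trans (ler_normB _ _)) // normrZ ger0_norm // -lerBrDl.
  have := xmin _ (mem_set Ap); have := xmin _ (mem_set An).
  rewrite /f /v !(dotp_addr, dotp_addl, dotpNr, dotpNl, dotp_scaler, dotp_scalel).
  by rewrite (dotpC h x); lra.
rewrite hH /dotp [X in _ <= 2 * X]big1 => [|i _]; last by rewrite mxE mul0r.
rewrite mulr0; apply/negP; rewrite -ltNge.
by rewrite !mulr_gt0 // dotp_gt0.
Unshelve. all: by end_near.
Qed.

(** The tangent planes at 0 and at the points [x i] bound [w] below by 0 and by each [z i].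
    Averaging turns this into a bound on every [|z i|], and a left inverse [B] of [A] recovers [y]
    from the [z i]. *)
Lemma spanning_gradients_coercive m (A : 'M[R]_(m, n)) : row_full A ->
  (forall i, exists x, row i A = gradient u x - gradient u 0) ->
  exists p K C, 0 < K /\ forall y, `|y| <= K * (u y - dotp p y + C).
Proof.
move=> /row_fullP [B BA] HA.
have [x Hx] := fin_all_exists HA.
have uC1 := class_CS u_C2.
pose c i := u (x i) - dotp (gradient u (x i)) (x i).
(* This is the mean of the [m.+1] gradients at 0 and at the [x i]. *)
pose p := gradient u 0 + m.+1%:R^-1 *: \sum_i row i A.
pose b := \sum_j \sum_i `|B j i|.
have b0 : 0 <= b by apply: sumr_ge0 => j _; apply: sumr_ge0.
pose C := `|u 0| + \sum_i `|c i|.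
(* Here [b] bounds the action of [B] in the sup norm, [m.+1] comes from the averaging, and the final
   1 ensures positivity. *)
exists p, (b * m.+1%:R + 1), C; split; first by rewrite ltr_wpDl // mulr_ge0.
move=> y.
pose z i := dotp (row i A) y.
pose w := u y - dotp (gradient u 0) y + C.
have cC i : `|u 0| + `|c i| <= C.
  by rewrite lerD2l (bigD1 i) //= lerDl sumr_ge0.
have wz i : z i <= w.
  rewrite /z /w Hx dotp_addl dotpNl.
  have := convex_gradient_le u_convex (x i) (y - x i) uC1.
  rewrite subrKC dotp_addr dotpNr => H1.
  have := cC i; have := ler_normr (c i); have := normr_ge0 (u 0).
  have := ler_norm (- c i); rewrite normrN /c; lra.
have w0 : 0 <= w.
  have := convex_gradient_le u_convex 0 y uC1; rewrite add0r.
  have := ler_norm (- u 0); rewrite normrN /w /C.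
  have : 0 <= \sum_i `|c i| by apply: sumr_ge0.
  lra.
pose T := u y - dotp p y + C.
(* All summands on the right are nonnegative, so each is at most [m.+1%:R * T]; this controls [z i]
   from both sides. *)
have ET : m.+1%:R * T = w + \sum_i (w - z i).
  have dz : dotp (\sum_i row i A) y = \sum_i z i.
    apply: (big_ind2 (fun q s => dotp q y = s)) => [|? ? ? ? <- <-|//].
      by rewrite /dotp big1 // => i _; rewrite mxE mul0r.
    by rewrite dotp_addl.
  rewrite sumrB sumr_const card_ord /T /p dotp_addl dotp_scalel dz.
  have -> : u y - (dotp (gradient u 0) y + m.+1%:R^-1 * (\sum_i z i)) + C =
    w - m.+1%:R^-1 * (\sum_i z i) by rewrite /w; ring.
  rewrite mulrBr mulrA divff ?pnatr_eq0 // mul1r addrA.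
  rewrite -[w *+ m]mulr_natl; congr (_ - _).
  by rewrite -natr1 mulrDl mul1r addrC.
have S0 : 0 <= \sum_i (w - z i) by apply: sumr_ge0 => i _; rewrite subr_ge0.
have T0 : 0 <= T by rewrite -(@pmulr_rge0 _ m.+1%:R) // ET addr_ge0.
have zT i : `|z i| <= m.+1%:R * T.
  have : w - z i <= \sum_i (w - z i).
    rewrite [leRHS](bigD1 i) //= lerDl; apply: sumr_ge0 => j _.
    by rewrite subr_ge0.
  by have := wz i; rewrite ler_norml ET; lra.
apply: mx_norm_le => [|j]; first by rewrite mulr_ge0 // addr_ge0 // mulr_ge0.
have -> : y 0 j = \sum_i B j i * z i.
  rewrite -[y in LHS]trmxK mxE -[y^T]mul1mx -BA -mulmxA mxE.
  apply: eq_bigr => i _; congr (_ * _); rewrite mxE /z /dotp.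
  by apply: eq_bigr => k _; rewrite !mxE.
apply: le_trans (ler_norm_sum _ _ _) _.
apply: (@le_trans _ _ (\sum_i `|B j i| * (m.+1%:R * T))).
  by apply: ler_sum => i _; rewrite normrM ler_wpM2l.
rewrite -mulr_suml mulrDl -mulrA mul1r -[leLHS]addr0 lerD //.
rewrite ler_wpM2r // ?mulr_ge0 // /b [leRHS](bigD1 j) //= lerDl.
by apply: sumr_ge0 => k _; apply: sumr_ge0.
Qed.

Lemma degenerate_hessian_flat_direction :
  (forall x, \det (hessian u x) = 0) ->
  exists e, e != 0 /\ forall x, dotp (gradient u x) e = dotp (gradient u 0) e.
Proof.
move=> detH.
have [[e e0 He]|[m [A [fA SA]]]] :=
  row_full_or_orthogonal [set q | exists x, q = gradient u x - gradient u 0].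
  exists e^T; split.
    by apply: contra_neq e0 => /(congr1 trmx); rewrite trmxK trmx0.
  move=> x; apply/eqP; rewrite -subr_eq0 -dotpNl -dotp_addl.
  have /matrixP /(_ 0 0) := He _ (ex_intro _ x erefl); rewrite !mxE => E.
  by rewrite -[X in _ == X]E; apply/eqP; apply: eq_bigr => i _; rewrite !mxE.
have [p [K [C [K0 H]]]] := spanning_gradients_coercive fA SA.
by have [x] := coercive_det_neq0 K0 H; rewrite detH eqxx.
Qed.

End Touching.

(** * The trace bound, and curvature under translations *)

Lemma dotp_mulmx (R : realType) n (A : 'M[R]_n) (h k : 'rV[R]_n) :
  dotp (h *m A) k = \sum_i \sum_j h 0 i * k 0 j * A i j.
Proof.
rewrite exchange_big; apply: eq_bigr => j _; rewrite mxE mulr_suml.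
by apply: eq_bigr => i _; rewrite mulrAC.
Qed.

Lemma dotp_delta_mulmx (R : realType) n (A : 'M[R]_n) i j :
  dotp (delta_mx 0 i *m A) (delta_mx 0 j) = A i j.
Proof.
rewrite -rowE /dotp (bigD1 j) //= !mxE !eqxx mulr1 big1 ?addr0 // => k kj.
by rewrite !mxE (negbTE kj) andbF mulr0.
Qed.

(* [A] need not be symmetric: the difference of the two sides is half the sum
   over [i] and [j] of the values of the form at [a i *: e_j - a j *: e_i]. *)
Lemma psd_form_le_trace (R : realType) n (A : 'M[R]_n) (a : 'rV[R]_n) :
  (forall h, 0 <= dotp (h *m A) h) -> dotp (a *m A) a <= dotp a a * \tr A.
Proof.
move=> A0.
pose q i j := a 0 i ^+ 2 * A j j + a 0 j ^+ 2 * A i i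
  - a 0 i * a 0 j * A i j - a 0 j * a 0 i * A j i.
have q0 i j : 0 <= q i j.
  have := A0 (a 0 i *: delta_mx 0 j - a 0 j *: delta_mx 0 i).
  rewrite mulmxBl -!scalemxAl.
  rewrite !(dotp_addr, dotp_addl, dotpNr, dotpNl, dotp_scaler, dotp_scalel).
  by rewrite !dotp_delta_mulmx /q; congr (_ <= _); ring.
have : 0 <= \sum_i \sum_j q i j by apply: sumr_ge0 => i _; apply: sumr_ge0.
have E1 : \sum_i \sum_j a 0 i ^+ 2 * A j j = dotp a a * \tr A.
  rewrite /dotp mulr_suml; apply: eq_bigr => i _.
  by rewrite -expr2 /mxtrace mulr_sumr.
have -> : \sum_i \sum_j q i j = 2 * (dotp a a * \tr A - dotp (a *m A) a).
  rewrite /q; under eq_bigr do rewrite !sumrB big_split /=.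
  rewrite !sumrB big_split /= E1.
  rewrite [X in _ + X - _ - _]exchange_big /= E1.
  by rewrite [X in _ - _ - X]exchange_big /= -dotp_mulmx; ring.
by rewrite pmulr_rge0 // subr_ge0.
Qed.

Lemma wE_gt0 (R : realType) n (u : 'rV[R]_n -> R) x : 0 < wE u x.
Proof. by rewrite ltr_wpDr // sqr_ge0. Qed.

Lemma enorm_sqr (R : realType) n (x : 'rV[R]_n) : enorm x ^+ 2 = dotp x x.
Proof. by rewrite sqr_sqrtr // dotp_ge0. Qed.

Lemma enorm_ge_entry (R : realType) n (x : 'rV[R]_n) i : x 0 i <= enorm x.
Proof.
apply: le_trans (ler_norm _) _; rewrite -sqrtr_sqr ler_wsqrtr //.
rewrite /dotp (bigD1 i) //= -expr2 lerDl; apply: sumr_ge0 => j _.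
by rewrite -expr2 sqr_ge0.
Qed.

Lemma gauss_curvature_eq0 (R : realType) n (u : 'rV[R]_n -> R) x :
  gauss_curvature u x = 0 -> \det (hessian u x) = 0.
Proof.
move=> /eqP; rewrite mulf_eq0 => /orP [|/eqP //].
by rewrite gt_eqF // powR_gt0 // wE_gt0.
Qed.

(** The constant [k] cancels in difference quotients. It is the increment of [u] at first order and
    0 when the lemma is applied again to the partial derivatives. *)
Lemma partial_translation (R : realType) n (f : 'rV[R]_n -> R) a k i :
  (forall y, f (y + a) = f y + k) ->
  forall y, partial i f (y + a) = partial i f y.
Proof.
move=> fa y; rewrite /partial /derive.
suff -> : (fun h : R => h^-1 *: ((f \o shift (y + a)) (h *: delta_mx 0 i)
                                  - f (y + a)))
    = (fun h : R => h^-1 *: ((f \o shift y) (h *: delta_mx 0 i) - f y)) by [].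
apply/funext => t /=; rewrite addrA !fa; congr (_ *: _).
by rewrite opprD addrACA subrr addr0.
Qed.

Lemma mean_curvature_translation (R : realType) n (u : 'rV[R]_n -> R) a k :
  (forall y, u (y + a) = u y + k) ->
  forall y, mean_curvature u (y + a) = mean_curvature u y.
Proof.
move=> ua y.
have pa i := partial_translation i ua.
have ppa i j : partial i (partial j u) (y + a) = partial i (partial j u) y.
  have H z : partial j u (z + a) = partial j u z + 0 by rewrite addr0; exact: pa.
  exact: (partial_translation i H).
have ga : gradient u (y + a) = gradient u y by apply/rowP => i; rewrite !mxE pa.
have lapa : laplacian u (y + a) = laplacian u y.
  by apply: eq_bigr => i _; exact: ppa.
have suma : \sum_i \sum_j partial i u (y + a) * partial j u (y + a)
      * partial i (partial j u) (y + a)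
    = \sum_i \sum_j partial i u y * partial j u y * partial i (partial j u) y.
  by apply: eq_bigr => i _; apply: eq_bigr => j _; rewrite !pa ppa.
have wa : wE u (y + a) = wE u y by rewrite /wE ga.
rewrite /mean_curvature wa lapa.
exact (congr1 (fun s => wE u y `^ (- (3 / 2)) * (wE u y * laplacian u y - s))
  suma).
Qed.

(** * Vanishing of the mean curvature and affineness *)

Section Vanishing.
Variables (R : realType) (n : nat) (u : 'rV[R]_n -> R).

Lemma constant_slope_affine x e (c : R) : class_C 1 u ->
  (forall t, dotp (gradient u (x + t *: e)) e = c) ->
  forall t, u (x + t *: e) = u x + t * c.
Proof.
move=> uC He t.
have D s : is_derive s (1 : R) ((fun s => u (x + s *: e)) - c \*: id) 0.
  have D1 : is_derive s (1 : R) (fun s => u (x + s *: e)) c.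
    by apply: is_derive_line; rewrite -(He s); exact: class_C_is_derive.
  have D2 : is_derive s (1 : R) (c \*: id) (c *: (1 : R)).
    by apply: is_deriveZ; exact: is_derive_id.
  apply: is_derive_eq (is_deriveB D1 D2) _.
  by rewrite -[c *: _]/(c * 1) mulr1 subrr.
have := is_derive_0_is_cst t 0 D.
rewrite -[LHS]/(u (x + t *: e) - c * t) -[RHS]/(u (x + 0 *: e) - c * 0).
rewrite scale0r addr0 mulr0 subr0 => <-; ring.
Qed.

(** Each line in direction [e] leaves every ball while the curvature stays constant on it, so that
    constant is the limit at infinity. *)
Lemma mean_curvature_eq0 e : e != 0 ->
  (forall x t, mean_curvature u (x + t *: e) = mean_curvature u x) ->
  mean_curvature u x @[x --> infty_nbhs R n] --> (0 : R) ->
  forall x, mean_curvature u x = 0.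
Proof.
move=> e0 He Hlim x; apply: contrapT => /eqP m0.
have [M HM] : \forall y \near infty_nbhs R n,
    `|0 - mean_curvature u y| < `|mean_curvature u x|.
  by move/cvgrPdist_lt : Hlim; apply; rewrite normr_gt0.
have /matrix0Pn [j [i]] := e0; rewrite ord1 => ei.
(* This moves the coordinate [i] of [x + t *: e] to [|M| + 1]. *)
pose t := (`|M| + 1 - x 0 i) / e 0 i.
have : M < enorm (x + t *: e).
  apply: lt_le_trans (enorm_ge_entry _ i).
  rewrite !mxE /t mulfVK // addrCA subrr addr0.
  by rewrite (le_lt_trans (ler_norm M)) // ltrDl.
by move=> /HM; rewrite He sub0r normrN ltxx.
Qed.

Hypotheses (u_C2 : class_C 2 u) (u_convex : convex_function [set: 'rV[R]_n] u).

Lemma mean_curvature_eq0_hessian x h : mean_curvature u x = 0 ->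
  dotp (h *m hessian u x) h = 0.
Proof.
move=> /eqP; rewrite mulf_eq0 gt_eqF ?powR_gt0 ?wE_gt0 //= => /eqP.
have -> : laplacian u x = \tr (hessian u x).
  by apply: eq_bigr => i _; rewrite mxE.
have -> : \sum_i \sum_j partial i u x * partial j u x * partial i (partial j u) x
    = dotp (gradient u x *m hessian u x) (gradient u x).
  rewrite dotp_mulmx; apply: eq_bigr => i _; apply: eq_bigr => j _.
  by rewrite !mxE.
rewrite /wE enorm_sqr => H0.
have psd k := convex_hessian_ge0 u_convex x k u_C2.
have Ha := psd_form_le_trace (gradient u x) psd.
(* With [a] the gradient and [Q] the Hessian form, [0 = (1 + |a|^2) tr Q - Q(a) >= tr Q]. *)
have tr0 : \tr (hessian u x) <= 0 by lra.
apply/eqP; rewrite eq_le psd andbT.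
by rewrite (le_trans (psd_form_le_trace h psd)) // mulr_ge0_le0 // dotp_ge0.
Qed.

Lemma mean_curvature_eq0_affine : (forall x, mean_curvature u x = 0) ->
  forall y, u y = u 0 + dotp (gradient u 0) y.
Proof.
move=> H0 y.
(* Along the line through 0 and [y], the slope has derivative equal to the Hessian form at [y],
   which is zero. *)
have G t : dotp (gradient u (0 + t *: y)) y = dotp (gradient u 0) y.
  have D s : is_derive s (1 : R) (fun s => dotp (gradient u (0 + s *: y)) y) 0.
    apply: (@is_derive_line _ _ (fun z => dotp (gradient u z) y)).
    rewrite -(mean_curvature_eq0_hessian y (H0 (0 + s *: y))).
    exact: is_derive_dotp_gradient.
  by rewrite (is_derive_0_is_cst t 0 D) scale0r addr0.
have := constant_slope_affine (class_CS u_C2) G 1.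
by rewrite scale1r add0r mul1r.
Qed.

End Vanishing.

(** * Graphs of affine functions, and the conclusion *)

Lemma graph_affine_hyperplane (R : realType) n (u : 'rV[R]_n -> R) a b :
  (forall y, u y = b + dotp a y) -> is_hyperplane (graph_of u).
Proof.
(* The normal [(a, -1)] is nonzero through its last entry, whatever [a] is. *)
move=> ua; exists (row_mx a (const_mx (- 1))), (- b); split.
  apply/eqP => /rowP /(_ (rshift n 0)) /eqP.
  by rewrite row_mxEr !mxE oppr_eq0 oner_eq0.
have E y (s : 'rV[R]_1) :
    dotp (row_mx a (const_mx (- 1))) (row_mx y s) = dotp a y - s 0 0.
  rewrite /dotp big_split_ord big_ord1 /= row_mxEr [in X in _ + X]row_mxEr.
  rewrite mxE mulN1r.
  by congr (_ - _); apply: eq_bigr => i _; rewrite !row_mxEl.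
apply/seteqP; split => [_ [y _ <-]|p] /=.
  by rewrite E mxE ua; ring.
rewrite -(hsubmxK p) E => Hp; exists (lsubmx p) => //.
congr row_mx; apply/rowP => i; rewrite ord1 mxE ua.
by apply/eqP; rewrite -subr_eq0 -addrA Hp subrr.
Qed.

Theorem theorem1p3 (R : realType) (n : nat) (u : 'rV[R]_n -> R)
  (u_C4 : class_C 4 u)
  (u_convex : convex_function [set: 'rV[R]_n] u)
  (K_eq0 : forall x : 'rV[R]_n, gauss_curvature u x = 0)
  (H_lim0 : mean_curvature u x @[x --> infty_nbhs R n] --> (0 : R)) :
  is_hyperplane (graph_of u).
Proof.
have u_C2 : class_C 2 u by do 2 apply: class_CS.
have [e [e0 He]] := degenerate_hessian_flat_direction u_C2 u_convex
  (fun x => gauss_curvature_eq0 (K_eq0 x)).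
have Ht t y : u (y + t *: e) = u y + t * dotp (gradient u 0) e.
  by apply: (constant_slope_affine (class_CS u_C2)) => s; exact: He.
apply: graph_affine_hyperplane; apply: mean_curvature_eq0_affine => //.
apply: mean_curvature_eq0 e0 _ H_lim0 => x t.
exact: mean_curvature_translation (Ht t) x.
Qed.
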